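(* Let $\mathcal V$ be a congruence modular variety, let $\mathbb A\in\mathcal V$, and let $\theta_0,\theta_1,\theta_2,\delta$ be congruences of $\mathbb A$. If $C(\theta_0,\theta_1,\theta_2;\delta)$ holds, then $C_{tr}(\theta_0,\theta_1,\theta_2;j;\delta)$ holds for each coordinate $j\in\{0,1,2\}$.
   Context: Throughout $2=\{0,1\}$, $n=\{0,\dots,n-1\}$, $\mathbb A$ is an algebra with universe $A$, and $\operatorname{Con}(\mathbb A)$ is its congruence lattice. Matrices. For $i\in 3$ and $a,b\in A$, $\operatorname{cube}_i^3(a,b)\in A^{2^3}$ is the element whose value at $f\in 2^3$ is $a$ if $f_i=0$ and $b$ if $f_i=1$. $M(\theta_0,\theta_1,\theta_2)$ is the subalgebra of $\mathbb A^{2^3}$ generated by all $\operatorname{cube}_i^3(a,b)$ with $i\in 3$, $\langle a,b\rangle\in\theta_i$. Lines. For $m\in A^{2^3}$ and $j\in 3$, a line of $m$ in direction $j$ is a pair $\langle m_f,m_g\rangle$, where $f,g\in 2^3$ agree off coordinate $j$ and $f_j=0$, $g_j=1$. The $(j)$-pivot line is the one for which both other coordinates equal $1$; the remaining three lines in direction $j$ are the $(j)$-supporting lines. Term condition. $C(\theta_0,\theta_1,\theta_2;j;\delta)$ means: for every $m\in M(\theta_0,\theta_1,\theta_2)$, if every $(j)$-supporting line of $m$ is in $\delta$, then the $(j)$-pivot line of $m$ is in $\delta$. It is known that for algebras in congruence modular varieties this condition does not depend on $j\in 3$, and one writes $C(\theta_0,\theta_1,\theta_2;\delta)$. Complexes.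 For $n_0,n_1,n_2\ge 2$, a $(\theta_0,\theta_1,\theta_2)$-matrix complex with dimensions $(n_0,n_1,n_2)$ is an element $a\in A^{n_0\times n_1\times n_2}$ such that for every $f\in n_0\times n_1\times n_2$ with $f_i<n_i-1$ for all $i\in 3$, the element $(a_{f+g})_{g\in 2^3}$ of $A^{2^3}$ belongs to $M(\theta_0,\theta_1,\theta_2)$. The corner of $a$ is $\operatorname{Corner}(a)\in A^{2^3}$, $\operatorname{Corner}(a)_g=a_{\gamma(g)}$, where $\gamma(g)_i=0$ if $g_i=0$ and $\gamma(g)_i=n_i-1$ if $g_i=1$. A $(\theta_0,\theta_1,\theta_2)$-corner is an element of the form $\operatorname{Corner}(a)$ for a $(\theta_0,\theta_1,\theta_2)$-matrix complex $a$ of some dimensions. Transitive term condition. $C_{tr}(\theta_0,\theta_1,\theta_2;j;\delta)$ means: for every $(\theta_0,\theta_1,\theta_2)$-corner $c$, if every $(j)$-supporting line of $c$ is in $\delta$, then the $(j)$-pivot line of $c$ is in $\delta$. *)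

(* Defs.v *)
From Stdlib Require Import RelationClasses.
From mathcomp Require Import all_boot.

Set Implicit Arguments.
Unset Strict Implicit.
Unset Printing Implicit Defensive.

(** * Algebras, subalgebras, products, congruences *)

Record signature := Signature { symbol : Type; arity : symbol -> nat }.

(* Operations are finitary.  Empty universes are allowed; this only adds an
   algebra for which every statement about congruences is trivial. *)
Record algebra (S : signature) := Algebra {
  carrier :> Type;
  interp : forall o : symbol S, ('I_(arity o) -> carrier) -> carrier
}.

Definition homomorphism (S : signature) (A B : algebra S) (h : A -> B) : Prop :=
  forall (o : symbol S) (x : 'I_(arity o) -> A),
    h (interp x) = interp (fun k => h (x k)).

Definition subuniverse (S : signature) (A : algebra S) (P : A -> Prop) : Prop :=
  forall (o : symbol S) (x : 'I_(arity o) -> A),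
    (forall k, P (x k)) -> P (interp x).

Definition subalgebra (S : signature) (A : algebra S) (P : A -> Prop)
    (hP : subuniverse P) : algebra S :=
  @Algebra S {x : A | P x} (fun o x =>
    exist P (interp (fun k => sval (x k)))
            (hP o (fun k => sval (x k)) (fun k => proj2_sig (x k)))).

Definition generated (S : signature) (A : algebra S) (G : A -> Prop) (x : A) :
    Prop :=
  forall P : A -> Prop, subuniverse P -> (forall y, G y -> P y) -> P x.

Definition product (S : signature) (I : Type) (B : I -> algebra S) : algebra S :=
  @Algebra S (forall i, B i) (fun o x i => interp (fun k => x k i)).

Definition power (S : signature) (A : algebra S) (I : Type) : algebra S :=
  product (fun _ : I => A).

Record congruence (S : signature) (A : algebra S) := Congruence {
  crel :> A -> A -> Prop;
  crel_equiv : Equivalence crel;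
  crel_compat : forall (o : symbol S) (x y : 'I_(arity o) -> A),
    (forall k, crel (x k) (y k)) -> crel (interp x) (interp y)
}.

(** * The congruence lattice *)

Definition con_le (S : signature) (A : algebra S) (a b : congruence A) : Prop :=
  forall x y, a x y -> b x y.

Definition con_eq (S : signature) (A : algebra S) (a b : congruence A) : Prop :=
  forall x y, a x y <-> b x y.

Definition con_meet (S : signature) (A : algebra S) (a b : congruence A) :
  congruence A.
Proof.
exists (fun x y => a x y /\ b x y).
- have [ra sa ta] := crel_equiv a; have [rb sb tb] := crel_equiv b.
  by split=> [x | x y [] | x y z [? ?] [? ?]]; split; eauto.
- by move=> o x y xy; split; apply: crel_compat => k; case: (xy k).
Defined.

Definition con_join (S : signature) (A : algebra S) (a b : congruence A) :
  congruence A.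
Proof.
exists (fun x y => forall c : congruence A, con_le a c -> con_le b c -> c x y).
- split=> [x c _ _ | x y xy c ac bc | x y z xy yz c ac bc];
    have [rc sc tc] := crel_equiv c; eauto.
- by move=> o x y xy c ac bc; apply: crel_compat => k; apply: xy.
Defined.

Definition congruence_modular_algebra (S : signature) (A : algebra S) : Prop :=
  forall a b c : congruence A, con_le a c ->
    con_eq (con_join a (con_meet b c)) (con_meet (con_join a b) c).

(** * Varieties *)

Record variety (S : signature) (V : algebra S -> Prop) : Prop := Variety {
  variety_image : forall (A B : algebra S) (h : A -> B),
    V A -> homomorphism h -> (forall b, exists a, h a = b) -> V B;
  variety_sub : forall (A : algebra S) (P : A -> Prop) (hP : subuniverse P),
    V A -> V (subalgebra hP);
  variety_product : forall (I : Type) (B : I -> algebra S),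
    (forall i, V (B i)) -> V (product B)
}.

Definition congruence_modular (S : signature) (V : algebra S -> Prop) : Prop :=
  forall A : algebra S, V A -> congruence_modular_algebra A.

(** * Matrices and the term condition *)

(* The index set 2^3, with 0 = false and 1 = true. *)
Definition vertex := 'I_3 -> bool.

Definition cube (T : Type) (i : 'I_3) (a b : T) : vertex -> T :=
  fun f => if f i then b else a.

Definition matrices (S : signature) (A : algebra S)
    (theta : 'I_3 -> congruence A) : power A vertex -> Prop :=
  generated (fun m : power A vertex =>
    exists (i : 'I_3) (a b : A), theta i a b /\ m = cube i a b).

Definition line (j : 'I_3) (f g : vertex) : Prop :=
  [/\ f j = false, g j = true & forall i, i != j -> f i = g i].

Definition pivot_line (j : 'I_3) (f g : vertex) : Prop :=
  line j f g /\ forall i, i != j -> f i = true.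

Definition supporting_line (j : 'I_3) (f g : vertex) : Prop :=
  line j f g /\ ~ pivot_line j f g.

Definition supports_imply_pivot (S : signature) (A : algebra S)
    (X : (vertex -> A) -> Prop) (j : 'I_3) (delta : congruence A) : Prop :=
  forall m : vertex -> A, X m ->
    (forall f g, supporting_line j f g -> delta (m f) (m g)) ->
    forall f g, pivot_line j f g -> delta (m f) (m g).

Definition term_condition (S : signature) (A : algebra S)
    (theta : 'I_3 -> congruence A) (j : 'I_3) (delta : congruence A) : Prop :=
  supports_imply_pivot (matrices theta) j delta.

(** * Complexes, corners and the transitive term condition *)

Definition grid (n : 'I_3 -> nat) := forall i : 'I_3, 'I_(n i).

Lemma grid_add_subproof (n : 'I_3 -> nat) (f : grid n)
    (hf : forall i, f i < (n i).-1) (g : vertex) (i : 'I_3) :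
  f i + g i < n i.
Proof.
have fi : (f i).+1 < n i by rewrite -ltn_predRL.
by apply: leq_ltn_trans fi; rewrite -addn1 leq_add2l leq_b1.
Qed.

Definition grid_add (n : 'I_3 -> nat) (f : grid n)
    (hf : forall i, f i < (n i).-1) (g : vertex) : grid n :=
  fun i => Ordinal (grid_add_subproof hf g i).

Definition matrix_complex (S : signature) (A : algebra S)
    (theta : 'I_3 -> congruence A) (n : 'I_3 -> nat) (a : grid n -> A) : Prop :=
  forall (f : grid n) (hf : forall i, f i < (n i).-1),
    matrices theta (fun g => a (grid_add hf g)).

Lemma grid_corner_subproof (n : 'I_3 -> nat) (hn : forall i, 2 <= n i)
    (g : vertex) (i : 'I_3) :
  (if g i then (n i).-1 else 0) < n i.
Proof. by have := hn i; case: (n i) => // k _; case: (g i). Qed.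

Definition grid_corner (n : 'I_3 -> nat) (hn : forall i, 2 <= n i)
    (g : vertex) : grid n :=
  fun i => Ordinal (grid_corner_subproof hn g i).

Definition corner (T : Type) (n : 'I_3 -> nat) (hn : forall i, 2 <= n i)
    (a : grid n -> T) : vertex -> T :=
  fun g => a (grid_corner hn g).

Definition is_corner (S : signature) (A : algebra S)
    (theta : 'I_3 -> congruence A) (c : vertex -> A) : Prop :=
  exists (n : 'I_3 -> nat) (hn : forall i, 2 <= n i) (a : grid n -> A),
    matrix_complex theta a /\ c = corner hn a.

Definition transitive_term_condition (S : signature) (A : algebra S)
    (theta : 'I_3 -> congruence A) (j : 'I_3) (delta : congruence A) : Prop :=
  supports_imply_pivot (is_corner theta) j delta.

(* Main.v *)
(* Call a subalgebra R of A^(2^3) admissible if it is closed under collapsing a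
   cube onto any of its faces, and let [compose i R] be the set of cubes obtained
   by gluing two cubes of R along a face orthogonal to direction i. A Day operation
   applied to collapses of a cube exchanges two directions j and k, making the
   supporting k-lines off the transported face constant. Hence, for distinct
   i, j, k, the term condition for R in direction k yields the one for
   [compose i R], and a fortiori for R, in direction j. Thus the term condition in
   all directions survives gluing, and every corner of a complex is obtained from
   M by iterated gluing. *)

Require Import Defs.
From Stdlib Require Import FunctionalExtensionality RelationClasses Relation_Operators.
From mathcomp Require Import all_boot.

Set Implicit Arguments.
Unset Strict Implicit.
Unset Printing Implicit Defensive.

(** * Day operations *)

Section Congruences.
Variables (S : signature) (A : algebra S).

Lemma con_refl (a : congruence A) x : a x x.
Proof. by have [r _ _] := crel_equiv a; exact: (r x). Qed.

Lemma con_sym (a : congruence A) x y : a x y -> a y x.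
Proof. by have [_ s _] := crel_equiv a; exact: (s x y). Qed.

Lemma con_trans (a : congruence A) y x z : a x y -> a y z -> a x z.
Proof. by have [_ _ t] := crel_equiv a; exact: (t x y z). Qed.

Lemma generated_subuniverse (G : A -> Prop) : subuniverse (generated G).
Proof. by move=> o x Gx P hP GP; apply: (hP o x) => k; apply: (Gx k). Qed.

Lemma generated_incl (G : A -> Prop) x : G x -> generated G x.
Proof. by move=> Gx P _; apply. Qed.

(* Change the arguments of an operation one at a time. *)
Lemma rt_compat (Q : A -> A -> Prop) :
  (forall (o : symbol S) (x : 'I_(arity o) -> A) k p q, Q p q ->
     Q (interp (fun l => if l == k then p else x l))
       (interp (fun l => if l == k then q else x l))) ->
  forall (o : symbol S) (x y : 'I_(arity o) -> A),
    (forall k, clos_refl_trans A Q (x k) (y k)) ->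
    clos_refl_trans A Q (interp x) (interp y).
Proof.
move=> Q1 o x y xy.
pose h m := fun l : 'I_(arity o) => if l < m then y l else x l.
have step m : m <= arity o -> clos_refl_trans A Q (interp x) (interp (h m)).
  elim: m => [_ | m IH lt_m].
    by rewrite (_ : h 0 = x); [apply: rt_refl | apply: functional_extensionality].
  apply: rt_trans (IH (ltnW lt_m)) _; pose k := Ordinal lt_m.
  pose g p := fun l => if l == k then p else h m l.
  have -> : h m = g (x k).
    apply: functional_extensionality => l; rewrite /g /h.
    by case: eqP => // ->; rewrite ltnn.
  have -> : h m.+1 = g (y k).
    apply: functional_extensionality => l; rewrite /g /h ltnS leq_eqVlt.
    case: (eqVneq l k) => [-> /= | nlk]; first by rewrite eqxx.
    by rewrite (_ : (l == m :> nat) = false) //; apply/negbTE.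
  elim: (xy k) => [p q | p | p q r _ IH1 _ IH2].
  - by move=> pq; apply: rt_step; apply: Q1.
  - exact: rt_refl.
  - exact: rt_trans IH1 IH2.
have := step _ (leqnn _); rewrite (_ : h (arity o) = y) //.
by apply: functional_extensionality => l; rewrite /h ltn_ord.
Qed.

(** The closure inherits symmetry from [a] and [b] and is compatible by [rt_compat], so it is a
    congruence above both. *)
Lemma con_join_rt (a b : congruence A) x y :
  con_join a b x y -> clos_refl_trans A (fun p q => a p q \/ b p q) x y.
Proof.
set Q := fun p q => _.
have eqQ : Equivalence (clos_refl_trans A Q).
  split=> [p | p q | p q r]; [exact: rt_refl | | exact: rt_trans].
  elim=> [{}p {}q pq | {}p | {}p {}q r _ qp _ rq]; last exact: rt_trans rq qp.
    by apply: rt_step; case: pq => /con_sym; [left | right].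
  exact: rt_refl.
have compQ : forall (o : symbol S) (x y : 'I_(arity o) -> A),
    (forall k, clos_refl_trans A Q (x k) (y k)) ->
    clos_refl_trans A Q (interp x) (interp y).
  apply: rt_compat => o z k p q [] pq; [left | right]; apply: crel_compat => l;
    by case: eqP => // _; apply: con_refl.
by move/(_ (Congruence eqQ compQ)); apply=> p q pq; apply: rt_step; [left | right].
Qed.

(** Term operations in variables [I], taken without syntax inside a power of [A], so that they form
    an algebra of any variety containing [A]. *)
Definition clone (I : Type) : power A (I -> A) -> Prop :=
  generated (fun t : power A (I -> A) => exists i, t = fun v => v i).

Lemma clone_subuniverse (I J : Type) (t : (I -> A) -> A)
    (P : power A J -> Prop) (m : I -> J -> A) :
  clone t -> subuniverse P -> (forall i, P (m i)) ->
  P (fun j => t (fun i => m i j)).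
Proof.
move=> ct sP Pm; apply: (ct (fun t => P (fun j => t (fun i => m i j)))).
  by move=> o x Px; apply: (sP o (fun k j => x k (fun i => m i j))).
by move=> _ [i ->]; apply: Pm.
Qed.

Lemma clone_compat (I : Type) (t : (I -> A) -> A) (d : congruence A) v w :
  clone t -> (forall i, d (v i) (w i)) -> d (t v) (t w).
Proof.
move=> ct vw; apply: (ct (fun t => d (t v) (t w))) => [o x xd | _ [i ->] //].
exact: crel_compat.
Qed.

End Congruences.

Lemma clone_is_subuniverse (S : signature) (A : algebra S) (I : Type) :
  subuniverse (@clone S A I).
Proof. exact: generated_subuniverse. Qed.

Definition clone_algebra (S : signature) (A : algebra S) (I : Type) : algebra S :=
  subalgebra (@clone_is_subuniverse S A I).

Section Day.
Variables (S : signature) (V : algebra S -> Prop).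
Hypotheses (hV : variety V) (hmod : congruence_modular V).
Variables (A : algebra S) (hA : V A).

(** When [E] is an equality pattern among variables, this is the kernel of identifying them. *)
Definition agree (I : Type) (E : (I -> A) -> Prop) : congruence (clone_algebra A I).
Proof.
exists (fun t u => forall v, E v -> sval t v = sval u v).
- by split=> [t | t u tu | t u w tu uw] v Ev //; [rewrite tu | rewrite tu // uw].
- move=> o x y xy v Ev /=; congr interp.
  by apply: functional_extensionality => k; apply: xy.
Defined.

Definition quad (T : Type) (a b c d : T) (p : bool * bool) : T :=
  if p.1 then (if p.2 then d else c) else (if p.2 then b else a).

Lemma quad_app (T U : Type) (a b c d : T -> U) (x : T) :
  (fun p => quad a b c d p x) = quad (a x) (b x) (c x) (d x).
Proof. by apply: functional_extensionality => [] [[] []]. Qed.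

(* Day's Maltsev condition, applied to a chain of quaternary term operations
   joining the first projection to the last one. *)
Lemma day_separation (d : congruence A) x y z w :
  d x z ->
  (forall t : (bool * bool -> A) -> A, clone t ->
     (forall u v, t (quad u v v u) = u) ->
     d (t (quad y y w w)) (t (quad y x z w))) ->
  d y w.
Proof.
move=> xz tP.
pose F := clone_algebra A (bool * bool).
have VF : V F by apply: (variety_sub hV); apply: (variety_product hV).
(* The first and last projections are related by the meet of [al] with the join of [ga] and [be]. As
   [ga] is below [al], modularity relates them by the join of [ga] with the meet of [be] and
   [al]. *)
pose al := agree (fun v => exists a b : A, v = quad a b b a).
pose be := agree (fun v => exists a b : A, v = quad a a b b).
pose ga := agree (fun v => exists a b c : A, v = quad a b b c).
have le_ga_al : con_le ga al by move=> t u tu v [a [b ->]]; apply: tu; exists a, b, a.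
have pr p : @clone S A _ (fun v : bool * bool -> A => v p).
  by apply: generated_incl; exists p.
pose pi p : F := exist _ _ (pr p).
have [_ modF] := hmod VF be le_ga_al (pi (false, false)) (pi (true, true)).
have /modF/con_join_rt : con_meet (con_join ga be) al
    (pi (false, false)) (pi (true, true)).
  split=> [c gac bec | v [a [b ->]]] //.
  apply: (con_trans (y := pi (false, true))).
    by apply: bec => v [a [b ->]].
  apply: (con_trans (y := pi (true, false))).
    by apply: gac => v [a [b [e ->]]].
  by apply: bec => v [a [b ->]].
have : forall u v, sval (pi (false, false)) (quad u v v u) = u by [].
(* Along the chain Day's identity persists and the values at [(y, x, z, w)] stay [d]-related; the
   end terms take the values [y] and [w]. *)
suff gen (s t : F) :
    clos_refl_trans F (fun p q => ga p q \/ con_meet be al p q) s t ->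
    (forall u v, sval s (quad u v v u) = u) ->
    (forall u v, sval t (quad u v v u) = u) /\
    d (sval s (quad y x z w)) (sval t (quad y x z w)).
  by move=> day0 /gen -/(_ day0) [].
elim=> [{}s {}t st day_s | {}s day_s | {}s {}t r _ IH1 _ IH2 day_s].
- have day_t u v : sval t (quad u v v u) = u.
    have alst : al s t by case: st => [/le_ga_al | []].
    by rewrite -alst //; exists u, v.
  (* A [ga] step passes through [(y, x, x, w)], thanks to [d x z]; a [be] step passes through
     [(y, y, w, w)], thanks to [tP]. *)
  split=> //; case: st => [gast | [best _]].
    have dq (r : F) : d (sval r (quad y x x w)) (sval r (quad y x z w)).
      apply: (clone_compat (proj2_sig r)) => [] [[] []] //=; exact: con_refl.
    apply: con_trans (con_sym (dq s)) _.
    by rewrite gast; [apply: dq | exists y, x, w].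
  apply: con_trans (con_sym (tP _ (proj2_sig s) day_s)) _.
  by rewrite best; [apply: (tP _ (proj2_sig t)) | exists y, w].
- by split=> //; apply: con_refl.
- by have [/IH2[? tr] st] := IH1 day_s; split=> //; apply: con_trans st tr.
Qed.

End Day.

(** * Cubes and their composition in one direction *)

Definition upd (f : vertex) (i : 'I_3) (b : bool) : vertex :=
  fun k => if k == i then b else f k.

Lemma upd_id f i b : f i = b -> upd f i b = f.
Proof.
move=> fi; apply: functional_extensionality => k; rewrite /upd.
by case: eqP => // ->.
Qed.

Lemma upd_upd f i b c : upd (upd f i b) i c = upd f i c.
Proof.
by apply: functional_extensionality => k; rewrite /upd; case: eqP.
Qed.

Lemma updC f i j b c : i != j -> upd (upd f i b) j c = upd (upd f j c) i b.
Proof.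
move=> ij; apply: functional_extensionality => k; rewrite /upd.
by case: (eqVneq k j) => // ->; rewrite eq_sym (negbTE ij).
Qed.

Lemma updE f i b : upd f i b i = b.
Proof. by rewrite /upd eqxx. Qed.

Lemma updNE f i b k : k != i -> upd f i b k = f k.
Proof. by rewrite /upd => /negbTE ->. Qed.

Lemma cover3 (i j k : 'I_3) : i != j -> i != k -> j != k ->
  forall l, [\/ l = i, l = j | l = k].
Proof.
move=> ij ik jk l; have: [|| l == i, l == j | l == k].
  by case: i j k l ij ik jk => [[|[|[|?]]] ?] [[|[|[|?]]] ?] [[|[|[|?]]] ?] [[|[|[|?]]] ?].
by case/or3P => /eqP ?; [apply: Or31 | apply: Or32 | apply: Or33].
Qed.

Lemma third_index (j k : 'I_3) : j != k -> exists i, i != j /\ i != k.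
Proof.
by case: j k => [[|[|[|//]]] pj] [[|[|[|//]]] pk] //= _;
  (exists (inord 0) + exists (inord 1) + exists (inord 2));
  by rewrite -!val_eqE /= inordK.
Qed.

Definition vtx (i j : 'I_3) (b c d : bool) : vertex :=
  fun l => if l == i then b else if l == j then c else d.

Lemma vtxE (i j k : 'I_3) b c d : i != j -> i != k -> j != k ->
  [/\ vtx i j b c d i = b, vtx i j b c d j = c & vtx i j b c d k = d].
Proof.
move=> ij ik jk; rewrite /vtx !eqxx !(eq_sym k) (eq_sym j i).
by rewrite (negbTE ij) (negbTE ik) (negbTE jk).
Qed.

Lemma vertex_ext (i j k : 'I_3) (f g : vertex) : i != j -> i != k -> j != k ->
  f i = g i -> f j = g j -> f k = g k -> f = g.
Proof.
move=> ij ik jk fi fj fk; apply: functional_extensionality => l.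
by case: (cover3 ij ik jk l) => ->.
Qed.

Lemma vtxC (i j k : 'I_3) b c d : i != j -> i != k -> j != k ->
  vtx i k b d c = vtx i j b c d.
Proof.
move=> ij ik jk; have kj : k != j by rewrite eq_sym.
have [vi vj vk] := vtxE b c d ij ik jk.
have [wi wk wj] := vtxE b d c ik ij kj.
by apply: (vertex_ext ij ik jk); congruence.
Qed.

(** * Admissible sets of cubes and their gluing *)

Section Cubes.
Variables (S : signature) (A : algebra S).
Implicit Types (R : power A vertex -> Prop) (d : congruence A).

Lemma supports_imply_pivotE R (i j k : 'I_3) d :
  i != j -> i != k -> j != k ->
  supports_imply_pivot R k d <->
  forall m, R m ->
    (forall b c, ~~ (b && c) -> d (m (vtx i j b c false)) (m (vtx i j b c true))) ->
    d (m (vtx i j true true false)) (m (vtx i j true true true)).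
Proof.
move=> ij ik jk.
have vE f : f = vtx i j (f i) (f j) (f k).
  have [vi vj vk] := vtxE (f i) (f j) (f k) ij ik jk.
  exact: (vertex_ext ij ik jk).
have vline b c : line k (vtx i j b c false) (vtx i j b c true).
  have [vi vj vk] := vtxE b c false ij ik jk.
  have [wi wj wk] := vtxE b c true ij ik jk.
  by split=> // l; case: (cover3 ij ik jk l) => ->; rewrite ?eqxx // ?vi ?vj.
split=> H m Rm sup => [ | f g [[fk gk fg] piv]]; last first.
  rewrite (vE f) (vE g) fk gk -!fg // !piv //.
  apply: H => // b c nbc; apply: sup; split=> // -[_ bc].
  have [vi vj _] := vtxE b c false ij ik jk.
  by move: nbc; rewrite -vi -[X in _ && X]vj !bc.
apply: (H m Rm) => [f g [[fk gk fg] npiv] | ].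
  rewrite (vE f) (vE g) fk gk -!fg //.
  apply: sup; apply/negP => /andP[fi fj]; apply: npiv; split=> // l.
  by case: (cover3 ij ik jk l) => ->; rewrite ?eqxx.
split=> // l; have [vi vj _] := vtxE true true false ij ik jk.
by case: (cover3 ij ik jk l) => ->; rewrite ?eqxx.
Qed.

(* Closure under the degeneracies [m |-> m o (f |-> f[i := b])] makes [R], seen
   as a relation between opposite faces, reflexive on its field. *)
Record admissible R : Prop := Admissible {
  admissible_sub : subuniverse R;
  admissible_upd : forall i b m, R m -> R (fun f => m (upd f i b))
}.

(** Relational composition of [R] with itself, cubes being pairs of opposite faces in direction [i];
    the shared middle face is forgotten. *)
Definition compose (i : 'I_3) R : power A vertex -> Prop := fun m =>
  exists m0 m1, [/\ R m0, R m1,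
    forall f, m0 (upd f i true) = m1 (upd f i false) &
    m = fun f => if f i then m1 f else m0 f].

(** Glue [m] to the degenerate cube on its far face. *)
Lemma compose_incl i R m : admissible R -> R m -> compose i R m.
Proof.
move=> [_ Ru] Rm; exists m, (fun f => m (upd f i true)); split=> //.
- exact: Ru.
- by move=> f; rewrite upd_upd.
- apply: functional_extensionality => f.
  by case fi: (f i) => //; rewrite upd_id.
Qed.

Lemma compose_admissible i R : admissible R -> admissible (compose i R).
Proof.
move=> adR; have [Rs Ru] := adR; split.
- move=> o x cx.
  have /fin_all_exists[x0 x0P] : forall k, exists m0, exists m1, [/\ R m0, R m1,
    forall f, m0 (upd f i true) = m1 (upd f i false) &
    x k = fun f => if f i then m1 f else m0 f] by [].
  have [x1 x01] := fin_all_exists x0P.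
  exists (interp x0), (interp x1); split.
  + by apply: Rs => k; have [] := x01 k.
  + by apply: Rs => k; have [] := x01 k.
  + move=> f /=; congr interp; apply: functional_extensionality => k.
    by have [_ _ ->] := x01 k.
  + apply: functional_extensionality => f /=.
    by case: ifP => fi; congr interp; apply: functional_extensionality => k;
      have [_ _ _ ->] := x01 k; rewrite fi.
- move=> j b _ [m0 [m1 [Rm0 Rm1 m01 ->]]].
  (* Collapsing along the gluing direction keeps one outer face, so the result is a collapse of [m0]
     or [m1] alone. *)
  have [-> | ij] := eqVneq i j.
    apply: compose_incl => //; rewrite (_ : (fun f => _) =
      fun f => if b then m1 (upd f j b) else m0 (upd f j b)).
      by case: (b); apply: Ru.
    by apply: functional_extensionality => f; rewrite updE.
  exists (fun f => m0 (upd f j b)), (fun f => m1 (upd f j b)); split.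
  + exact: Ru.
  + exact: Ru.
  + by move=> f; rewrite !(updC _ _ _ ij).
  + by apply: functional_extensionality => f; rewrite updNE.
Qed.
End Cubes.

Lemma upd_vtx i j b b' c d : upd (vtx i j b c d) i b' = vtx i j b' c d.
Proof.
by apply: functional_extensionality => l; rewrite /upd /vtx; case: eqP.
Qed.

(** * Transfer of the term condition through gluing *)

Section TermCondition.
Variables (S : signature) (V : algebra S -> Prop).
Hypotheses (hV : variety V) (hmod : congruence_modular V).
Variables (A : algebra S) (hA : V A) (d : congruence A).
Implicit Types R : power A vertex -> Prop.

(* The Day operation [t] turns the [j]-lines of a cube [m] over [k = 0, 1] into
   the [k]-line [(t (y, x, z, w), t (y, y, w, w))], opposite to a constant one.
   It is this line that the term condition for [k] transports along [i]. *)
Lemma day_transport R (i j k : 'I_3) (t : (bool * bool -> A) -> A) m :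
  i != j -> i != k -> j != k -> admissible R -> supports_imply_pivot R k d ->
  clone t -> (forall u v, t (quad u v v u) = u) -> R m ->
  let P b := t (quad (m (vtx i j b false true)) (m (vtx i j b false true))
                     (m (vtx i j b true true)) (m (vtx i j b true true))) in
  let Q b := t (quad (m (vtx i j b false true)) (m (vtx i j b false false))
                     (m (vtx i j b true false)) (m (vtx i j b true true))) in
  d (P false) (Q false) -> d (P true) (Q true).
Proof.
move=> ij ik jk [Rs Ru] CR ct t_day Rm P Q PQ0.
(* At [j = 0] the arguments have the form [(u, v, v, u)], so Day's identity removes the dependence
   on [k]; at [j = 1] they give [Q] for [k = 0] and [P] for [k = 1]. *)
pose n := fun f => t (quad (m (upd (upd f j false) k true)) (m (upd f j false))
                           (m f) (m (upd f k true))).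
have Rn : R n.
  pose q := quad (fun f => m (upd (upd f j false) k true))
    (fun f => m (upd f j false)) m (fun f => m (upd f k true)).
  have -> : n = fun f => t (fun p => q p f).
    by apply: functional_extensionality => f; rewrite quad_app.
  apply: (clone_subuniverse ct Rs) => -[[] []] //; first exact: Ru.
    exact: Ru.
  by apply: (Ru j false (fun f => m (upd f k true))); apply: Ru.
have updj b c e c' : upd (vtx i j b c e) j c' = vtx i j b c' e.
  have [vi vj vk] := vtxE b c e ij ik jk.
  have [wi wj wk] := vtxE b c' e ij ik jk.
  by apply: (vertex_ext ij ik jk); rewrite ?updE // updNE // ?vi ?vk // eq_sym.
have updk b c e e' : upd (vtx i j b c e) k e' = vtx i j b c e'.
  have [vi vj vk] := vtxE b c e ij ik jk.
  have [wi wj wk] := vtxE b c e' ij ik jk.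
  by apply: (vertex_ext ij ik jk); rewrite ?updE // updNE // ?vi ?vj.
have nP b : n (vtx i j b true true) = P b by rewrite /n !updj !updk.
have nQ b : n (vtx i j b true false) = Q b by rewrite /n !updj !updk.
have n0 b e : n (vtx i j b false e) = m (vtx i j b false true).
  by rewrite /n !updj !updk; case: e; rewrite t_day.
have := (supports_imply_pivotE R d ij ik jk).1 CR n Rn; rewrite nP nQ.
move=> H; apply: con_sym; apply: H => b [] nb; last by rewrite !n0; apply: con_refl.
by case: b nb => // _; rewrite nP nQ; apply: con_sym.
Qed.

(** Nothing is known about the lines of the forgotten middle face. Yet the relation between [P] and
    [Q] holds on the near face, crosses [m0] and then [m1] by [day_transport], and on the far face
    [day_separation] turns it into the pivot line. *)
Lemma compose_supports_imply_pivot R (i j k : 'I_3) :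
  i != j -> i != k -> j != k -> admissible R -> supports_imply_pivot R k d ->
  supports_imply_pivot (compose i R) j d.
Proof.
move=> ij ik jk adR CR; have kj : k != j by rewrite eq_sym.
apply/(supports_imply_pivotE _ _ ik ij kj) => m [m0 [m1 [R0 R1 m01 def_m]]] sup.
have m_false c e : m (vtx i j false c e) = m0 (vtx i j false c e).
  by rewrite def_m /vtx eqxx.
have m_true c e : m (vtx i j true c e) = m1 (vtx i j true c e).
  by rewrite def_m /vtx eqxx.
have m_mid c e : m0 (vtx i j true c e) = m1 (vtx i j false c e).
  by have := m01 (vtx i j true c e); rewrite !upd_vtx.
have {}sup b e : ~~ (b && e) -> d (m (vtx i j b false e)) (m (vtx i j b true e)).
  by move=> /sup; rewrite !(vtxC _ _ _ ij ik jk).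
rewrite !(vtxC _ _ _ ij ik jk) !m_true.
apply: (day_separation hV hmod hA (x := m1 (vtx i j true false false))
  (z := m1 (vtx i j true true false))) => [|t ct t_day].
  by have := sup true false isT; rewrite !m_true.
apply: (day_transport ij ik jk adR CR ct t_day R1).
rewrite -!m_mid; apply: (day_transport ij ik jk adR CR ct t_day R0).
have := sup false false isT; have := sup false true isT; rewrite !m_false.
set y := m0 _; set w := m0 _; set x := m0 _; set z := m0 _ => yw xz.
(* On the near face both [j]-lines are supporting: modulo [d] the arguments become [(y, y, y, y)]
   and [(y, x, x, y)], on which [t] returns [y]. *)
apply: (con_trans (y := y)); last apply: con_sym.
  rewrite -{3}(t_day y y); apply: (clone_compat ct) => -[[] []] /=;
    by [apply: con_sym | apply: con_refl].
rewrite -{2}(t_day y x); apply: (clone_compat ct) => -[[] []] /=;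
  by [apply: con_sym | apply: con_refl].
Qed.

Lemma supports_imply_pivot_all R (k : 'I_3) :
  admissible R -> supports_imply_pivot R k d ->
  forall j, supports_imply_pivot R j d.
Proof.
move=> adR CR j; have [-> // | jk] := eqVneq j k.
have [i [ij ik]] := third_index jk.
move=> m Rm; apply: (compose_supports_imply_pivot ij ik jk adR CR).
exact: compose_incl.
Qed.

Definition good R : Prop :=
  admissible R /\ forall j, supports_imply_pivot R j d.

Lemma good_compose i R : good R -> good (compose i R).
Proof.
move=> [adR CR]; have adC := compose_admissible i adR; split=> //.
have [j [k [ij ik jk]]] : exists j k : 'I_3, [/\ i != j, i != k & j != k].
  have [j ij] : exists j, i != j.
    by case: i {adC} => [[|n] pn]; [exists (inord 1) | exists ord0];
      rewrite -val_eqE /= ?inordK.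
  by have [k [ki kj]] := third_index ij; exists j, k; rewrite ij eq_sym ki eq_sym.
(* Gluing gives direction [j]; independence of the direction for the glued set gives the others,
   including [i] itself. *)
exact: (supports_imply_pivot_all adC
  (compose_supports_imply_pivot ij ik jk adR (CR k))).
Qed.

(** * Complexes *)

(** With [b] defined on all triples of naturals, boxes of any position and side lengths make sense
    without bounds. *)
Definition box (b : ('I_3 -> nat) -> A) (x D : 'I_3 -> nat) : power A vertex :=
  fun g => b (fun i => x i + g i * D i).

Definition resize (D : 'I_3 -> nat) (i : 'I_3) (n : nat) : 'I_3 -> nat :=
  fun l => if l == i then n else D l.

(** A box is lengthened by gluing on a slice of thickness 1. The slice is only known to be in [R],
    so the inclusion in [R'] is carried along to have both pieces in one set. *)
Lemma good_resize R b D i n : good R -> D i = 1 -> (forall x, R (box b x D)) ->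
  exists R', [/\ good R', forall m, R m -> R' m &
    forall x, R' (box b x (resize D i n.+1))].
Proof.
move=> gR Di Rb; elim: n => [|n [R' [gR' RR' R'b]]].
  exists R; split=> // x; rewrite (_ : resize D i 1 = D) //.
  by apply: functional_extensionality => l; rewrite /resize; case: eqP => // ->.
exists (compose i R'); split; first exact: good_compose.
  by move=> m /RR'; apply: compose_incl; case: gR'.
move=> x; exists (box b x (resize D i n.+1)).
exists (box b (fun l => x l + (l == i) * n.+1) D); split.
- exact: R'b.
- exact/RR'/Rb.
- move=> f; congr b; apply: functional_extensionality => l.
  rewrite /upd /resize; case: eqP => //= _; last by rewrite addn0.
  by rewrite !mul1n addn0.
- apply: functional_extensionality => f; rewrite /box /resize.
  case fi: (f i); congr b; apply: functional_extensionality => l.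
    case: (eqVneq l i) => [->|_]; last by rewrite addn0.
    by rewrite fi Di !mul1n -addnA addn1.
  by case: (eqVneq l i) => // ->; rewrite fi.
Qed.

Variable theta : 'I_3 -> congruence A.

Lemma matrices_admissible : admissible (matrices theta).
Proof.
split=> [|i b m Mm]; first exact: generated_subuniverse.
apply: (Mm (fun m => matrices theta (fun f => m (upd f i b)))).
  move=> o x Mx.
  exact: (@generated_subuniverse _ (power A vertex) _ o (fun k f => x k (upd f i b))).
move=> _ [l [p [q [pq ->]]]]; apply: generated_incl; exists l.
(* Collapsed along its own direction, a generator becomes constant, hence a generator by
   reflexivity. *)
have [-> | li] := eqVneq l i.
  exists (if b then q else p), (if b then q else p); split; first exact: con_refl.
  by apply: functional_extensionality => f; rewrite /cube updE; case: (f i).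
exists p, q; split=> //.
by apply: functional_extensionality => f; rewrite /cube updNE.
Qed.

Lemma admissible_or R (p : vertex) m : admissible R -> R m ->
  R (fun g => m (fun i => p i || g i)).
Proof.
move=> [_ Ru] Rm.
have Ru' i m' : R m' -> R (fun f => m' (if p i then upd f i true else f)).
  by move=> Rm'; case: (p i) => //; apply: Ru.
have /(Ru' (inord 0))/(Ru' (inord 1))/(Ru' (inord 2)) := Rm.
congr R; apply: functional_extensionality => g; congr m.
have n01 : inord 0 != inord 1 :> 'I_3 by rewrite -val_eqE /= !inordK.
have n02 : inord 0 != inord 2 :> 'I_3 by rewrite -val_eqE /= !inordK.
have n12 : inord 1 != inord 2 :> 'I_3 by rewrite -val_eqE /= !inordK.
apply: functional_extensionality => l.
by case: (cover3 n01 n02 n12 l) => ->; do 3! case: ifP => ?;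
  rewrite /upd ?eqxx ?(eq_sym (inord 2)) ?(eq_sym (inord 1) (inord 0))
    ?(negbTE n01) ?(negbTE n02) ?(negbTE n12).
Qed.

Lemma clamp_subproof (n x : nat) : 2 <= n -> minn x n.-1 < n.
Proof. by case: n => // n _; rewrite ltnS geq_minr. Qed.

Section Complex.
Variables (n : 'I_3 -> nat) (hn : forall i, 2 <= n i) (a : grid n -> A).

Definition clamp (x : 'I_3 -> nat) : A :=
  a (fun i => Ordinal (clamp_subproof (x i) (hn i))).

(* A unit cube sticking out of the grid is a degeneracy of one inside. *)
Lemma clamp_cell x : matrix_complex theta a ->
  matrices theta (box clamp x (fun _ => 1)).
Proof.
move=> ca.
(* The index [(n i).-2] is the last base of a unit cell; from [(n i).-1] on, that cell is collapsed
   onto its far face. *)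
have lt_f i : minn (x i) (n i).-2 < n i.
  by have := hn i; case: (n i) => [|[|k]] // _; rewrite ltnS leqW // geq_minr.
pose f : grid n := fun i => Ordinal (lt_f i).
have hf i : f i < (n i).-1.
  by rewrite /=; have := hn i; case: (n i) => [|[|k]] // _; rewrite ltnS geq_minr.
have := admissible_or (fun i => (n i).-1 <= x i) matrices_admissible (ca f hf).
congr matrices; apply: functional_extensionality => g; congr a.
apply: functional_extensionality_dep => i; apply: val_inj => /=.
have := hn i; case: (n i) => [|[|k]] //= _; rewrite muln1.
case: (leqP k.+1 (x i)) => [le_k | lt_k] /=.
  rewrite (minn_idPr (ltnW le_k)) addn1; apply/esym/minn_idPr.
  exact: leq_trans le_k (leq_addr _ _).
rewrite (minn_idPl _) //; apply/esym/minn_idPl.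
by case: (g i); rewrite ?addn1 ?addn0 // ltnW.
Qed.
End Complex.
End TermCondition.

Theorem theorem6p5 (S : signature) (V : algebra S -> Prop)
    (hV : variety V) (hmod : congruence_modular V)
    (A : algebra S) (hA : V A)
    (theta : 'I_3 -> congruence A) (delta : congruence A)
    (k : 'I_3) (hC : term_condition theta k delta) :
  forall j : 'I_3, transitive_term_condition theta j delta.
Proof.
move=> j _ [n [hn [a [ca ->]]]].
have g0 : good delta (matrices theta).
  have adM := matrices_admissible theta; split=> //.
  exact: (supports_imply_pivot_all hV hmod hA adM hC).
have b0 x := clamp_cell hn x ca.
have n01 : (inord 0 == inord 1 :> 'I_3) = false by rewrite -val_eqE /= !inordK.
have n02 : (inord 0 == inord 2 :> 'I_3) = false by rewrite -val_eqE /= !inordK.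
have n12 : (inord 1 == inord 2 :> 'I_3) = false by rewrite -val_eqE /= !inordK.
(* [good_resize] yields length one more than its argument, so [.-2] gives [(n i).-1], the side of
   the corner. *)
have [R1 [g1 _ b1]] := good_resize hV hmod hA (i := inord 0) (n (inord 0)).-2
  g0 erefl b0.
have [|R2 [g2 _ b2]] := good_resize hV hmod hA (i := inord 1) (n (inord 1)).-2
  g1 _ b1.
  by rewrite /resize eq_sym n01.
have [|R3 [g3 _ b3]] := good_resize hV hmod hA (i := inord 2) (n (inord 2)).-2
  g2 _ b2.
  by rewrite /resize eq_sym n12 eq_sym n02.
suff -> : corner hn a = box (clamp hn a) (fun _ => 0) (resize (resize (resize
    (fun _ => 1) (inord 0) (n (inord 0)).-2.+1)
    (inord 1) (n (inord 1)).-2.+1) (inord 2) (n (inord 2)).-2.+1).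
  exact: (g3.2 j).
apply: functional_extensionality => g; congr a.
apply: functional_extensionality_dep => i; apply: val_inj => /=.
set D := resize _ _ _; have -> : D i = (n i).-1.
  have n3 (l : 'I_3) : (n l).-2.+1 = (n l).-1.
    by have := hn l; case: (n l) => [|[]].
  rewrite /D /resize !n3.
  by case: (cover3 (negbT n01) (negbT n02) (negbT n12) i) => ->;
    rewrite ?eqxx ?n01 ?n02 ?n12.
by case: (g i); rewrite ?mul1n ?mul0n ?minnn ?min0n.
Qed.
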